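(* Let $a,b\in\mathbb N$ and let $S(a_{\mathbf t})$, $\mathbf t=(t_1,t_2)\in\mathbb R^2$, be the $(a+1)\times(a+1)$ matrix weight defined in the context. The matrix weight $S$ is indecomposable, i.e. $$\{T\in M_{a+1}(\mathbb C)\mid TS(a_{\mathbf t})=S(a_{\mathbf t})T^\ast\ \ \forall\,t_1,t_2\}=\mathbb R\,\mathrm{Id},$$ $$\{T\in M_{a+1}(\mathbb C)\mid TS(a_{\mathbf t})=S(a_{\mathbf t})T\ \ \forall\,t_1,t_2\}=\mathbb C\,\mathrm{Id}.$$
   Context: $\mathbb N=\{0,1,2,\dots\}$. For $a,b\in\mathbb N$, $0\le i,k\le a$ and $\mathbf t=(t_1,t_2)\in\mathbb R^2$ put $$q_{i,k}(\mathbf t)=(\cos t_1)^{a+b-k}\sum_{p=0}^{\min(i,k)}\frac{(-i)_p(-k)_p}{p!\,(-a)_p}(\cos^2t_2-\cos^2t_1)^p(\cos t_2)^{b+2i+k-2p},\qquad (x)_p=\prod_{l=0}^{p-1}(x+l),$$ which equals $(\cos t_1)^{a+b-k}(\cos t_2)^{b+2i+k}K_i\bigl(k;\tfrac{\cos^2t_2}{\cos^2t_2-\cos^2t_1},a\bigr)$ with $K_i$ a Krawtchouk polynomial. The matrix weight is $S(a_{\mathbf t})=Q_0(a_{\mathbf t})Q_0(a_{\mathbf t})^\ast$ with $(Q_0(a_{\mathbf t}))_{i,k}=q_{i,k}(\mathbf t)$, i.e. $S(a_{\mathbf t})_{i,j}=\sum_{k=0}^aq_{i,k}(\mathbf t)\,q_{j,k}(\mathbf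 t)$, $0\le i,j\le a$ (it is a polynomial in $\psi_1=\cos^2t_1+\cos^2t_2$ and $\psi_2=\cos^2t_1\cos^2t_2$). $T^\ast$ is the conjugate transpose. *)

(* Defs.v *)
From mathcomp Require Import all_boot all_order all_algebra.
From mathcomp Require Import complex.
From mathcomp Require Import all_classical all_reals all_analysis.

Set Implicit Arguments.
Unset Strict Implicit.
Unset Printing Implicit Defensive.

Import Order.TTheory GRing.Theory Num.Theory.

Local Open Scope ring_scope.
Local Open Scope complex_scope.
Local Open Scope sesquilinear_scope.

(* Rising factorial (x)_n. *)
Definition pochhammer (R : pzRingType) (x : R) (n : nat) : R :=
  \prod_(l < n) (x + l%:R).

(* For i, k <= a, all the truncated subtractions on exponents are exact and
   the denominators p! (-a)_p do not vanish. *)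
Definition q_entry (R : realType) (a b i k : nat) (t1 t2 : R) : R :=
  cos t1 ^+ (a + b - k) *
  \sum_(0 <= p < (minn i k).+1)
    pochhammer (- i%:R) p * pochhammer (- k%:R) p
      / (p`!%:R * pochhammer (- a%:R) p)
    * (cos t2 ^+ 2 - cos t1 ^+ 2) ^+ p
    * cos t2 ^+ (b + 2 * i + k - 2 * p).

Definition Q0 (R : realType) (a b : nat) (t1 t2 : R) : 'M[R[i]]_a.+1 :=
  \matrix_(i, k) (q_entry a b i k t1 t2)%:C.

Definition weight (R : realType) (a b : nat) (t1 t2 : R) : 'M[R[i]]_a.+1 :=
  Q0 a b t1 t2 *m (Q0 a b t1 t2)^t*.

Lemma weightE (R : realType) (a b : nat) (t1 t2 : R) i j :
  weight a b t1 t2 i j =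
  (\sum_(k < a.+1) q_entry a b i k t1 t2 * q_entry a b j k t1 t2)%:C.
Proof.
rewrite mxE rmorph_sum; apply: eq_bigr => k _.
rewrite !mxE [RHS]rmorphM; congr GRing.mul; exact: conjc_real.
Qed.

(* Main.v *)
(** Write X = cos² t1 and Y = cos² t2. Expanding (Y - X)^p turns the weight into a
    matrix polynomial S = Σ X^m Y^n C_(m,n), and an identity T S = S T' for all
    t1, t2 amounts to T C_(m,n) = C_(m,n) T' for all m, n. Comparing degrees,
    C_(a+b+n, b+n) is a nonzero multiple of the matrix unit E_(n,n), which forces
    T and T' to be diagonal with the same diagonal; and the entry (n+1, n) of
    C_(a+b+n, b+n+1) is positive, which forces the diagonal entries of T of
    indices n and n+1 to coincide. *)
Require Import Defs.
From mathcomp Require Import all_boot all_order all_algebra.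
From mathcomp Require Import complex.
From mathcomp Require Import all_classical all_reals all_analysis.
From mathcomp Require Import zify ring.
Import Order.TTheory GRing.Theory Num.Theory.

Local Open Scope ring_scope.
Local Open Scope complex_scope.
Local Open Scope sesquilinear_scope.
Local Open Scope classical_set_scope.

(** * Signs of the expansion coefficients *)

Lemma sign_pochhammerN_gt0 (R : realType) (n p : nat) :
  (p <= n)%N -> 0 < (-1) ^+ p * pochhammer (- n%:R : R) p.
Proof.
move=> pn; rewrite /pochhammer -[X in _ ^+ X]card_ord -prodrN.
apply: prodr_gt0 => l _; rewrite opprD opprK subr_gt0 ltr_nat.
exact: leq_trans (ltn_ord l) pn.
Qed.

Definition krawtchouk_coef (R : realType) (a i k p : nat) : R :=
  pochhammer (- i%:R) p * pochhammer (- k%:R) p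
    / (p`!%:R * pochhammer (- a%:R) p).

(** Each of the three Pochhammer factors has sign [(-1) ^+ p]; two of these signs cancel and one
    remains. *)
Lemma sign_krawtchouk_coef_gt0 (R : realType) (a i k p : nat) :
  (p <= i)%N -> (p <= k)%N -> (p <= a)%N ->
  0 < (-1) ^+ p * krawtchouk_coef R a i k p.
Proof.
move=> pi pk pa; rewrite /krawtchouk_coef.
have s2 : ((-1) ^+ p * (-1) ^+ p = 1 :> R) by rewrite -expr2 sqrr_sign.
have -> : (-1) ^+ p * (pochhammer (- i%:R) p * pochhammer (- k%:R) p
    / (p`!%:R * pochhammer (- a%:R) p)) =
    ((-1) ^+ p * pochhammer (- i%:R : R) p) *
    ((-1) ^+ p * pochhammer (- k%:R : R) p) /
    (p`!%:R * ((-1) ^+ p * pochhammer (- a%:R : R) p)).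
  rewrite !invfM invr_sign.
  move: s2; set s := (-1) ^+ p => s2.
  by rewrite -[LHS]mul1r -s2; ring.
by rewrite divr_gt0 // mulr_gt0 ?sign_pochhammerN_gt0 // ltr0n fact_gt0.
Qed.

(** The coefficient of X^u Y^(i-u) in [q_entry a b i k], once [cos t1 ^+ (a + b - k) * cos t2 ^+ (b
    + k)] is factored out. *)
Definition q_coef (R : realType) (a i k u : nat) : R :=
  \sum_(p < (minn i k).+1)
    krawtchouk_coef R a i k p * ((-1) ^+ u * 'C(p, u)%:R).

(** For maximal [u] the binomial 'C(p, u) kills every term but [p = u], so a single signed
    coefficient is left. *)
Lemma q_coef_top_gt0 (R : realType) (a i k : nat) :
  (i <= a)%N -> (k <= a)%N -> 0 < q_coef R a i k (minn i k).
Proof.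
move=> ia ka; rewrite /q_coef big_ord_recr /= big1 ?add0r; last first.
  by move=> p _; rewrite bin_small ?mulr0.
rewrite binn mulr1 mulrC sign_krawtchouk_coef_gt0 ?geq_minl ?geq_minr //.
by rewrite (leq_trans (geq_minl _ _)).
Qed.

(** * Expansion of the weight in powers of X and Y *)

Lemma q_entryE (R : realType) (a b i k : nat) (t1 t2 : R) :
  q_entry a b i k t1 t2 =
  cos t1 ^+ (a + b - k) * cos t2 ^+ (b + k) *
  \sum_(u < (minn i k).+1)
    q_coef R a i k u * ((cos t1 ^+ 2) ^+ u * (cos t2 ^+ 2) ^+ (i - u)).
Proof.
rewrite /q_entry -mulrA; congr (_ * _).
rewrite big_mkord mulr_sumr.
under [RHS]eq_bigr => u _.
  rewrite /q_coef mulr_suml mulr_sumr; over.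
rewrite exchange_big /=; apply: eq_bigr => p _.
have pm : (p <= minn i k)%N by rewrite -ltnS.
have pi : (p <= i)%N by rewrite (leq_trans pm) ?geq_minl.
rewrite -/(krawtchouk_coef R a i k p) exprBn mulr_sumr mulr_suml.
(* The binomial sum over u <= p is extended to u <= min(i, k); the added terms contain a vanishing
   binomial. *)
rewrite (big_ord_widen (minn i k).+1 (fun u => krawtchouk_coef R a i k p *
  ((-1) ^+ u * (cos t2 ^+ 2) ^+ (p - u) * (cos t1 ^+ 2) ^+ u *+ 'C(p, u)) *
  cos t2 ^+ (b + 2 * i + k - 2 * p))) // big_mkcond.
apply: eq_bigr => u _; case: ltnP => [up|pu]; last first.
  by rewrite bin_small // !mulr0n !mulr0 mul0r mulr0.
(* This splitting leaves (Y - X)^p Y^(i-p), homogeneous of degree i in X and Y. *)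
have -> : (b + 2 * i + k - 2 * p = (b + k) + 2 * (i - p))%N by lia.
have -> : (i - u = (p - u) + (i - p))%N by lia.
rewrite (exprD _ (b + k)) (exprM _ 2) (exprD _ (p - u)) -mulr_natr; ring.
Qed.

(* The coefficient of X^m Y^n in the entry (i, j) of the weight. *)
Definition weight_coef (R : realType) (a b m n i j : nat) : R :=
  \sum_(k < a.+1) \sum_(u < (minn i k).+1) \sum_(v < (minn j k).+1)
    if (m == a + b - k + u + v)%N && (n == b + k + (i - u) + (j - v))%N
    then q_coef R a i k u * q_coef R a j k v else 0.

Lemma weight_entryE (R : realType) (a b i j : nat) (t1 t2 : R) :
  (i <= a)%N -> (j <= a)%N ->
  \sum_(k < a.+1) q_entry a b i k t1 t2 * q_entry a b j k t1 t2 =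
  \sum_(m < (3 * a + b).+1) \sum_(n < (3 * a + b).+1)
    weight_coef R a b m n i j * ((cos t1 ^+ 2) ^+ m * (cos t2 ^+ 2) ^+ n).
Proof.
move=> ia ja.
pose term (k u v : nat) : R := q_coef R a i k u * q_coef R a j k v *
   ((cos t1 ^+ 2) ^+ (a + b - k + u + v) *
    (cos t2 ^+ 2) ^+ (b + k + (i - u) + (j - v))).
transitivity (\sum_(k < a.+1) \sum_(u < (minn i k).+1)
    \sum_(v < (minn j k).+1) term k u v).
  apply: eq_bigr => k _; rewrite !q_entryE mulrACA mulr_suml mulr_sumr.
  apply: eq_bigr => u _; rewrite !mulr_sumr; apply: eq_bigr => v _.
  by rewrite /term !exprD -!exprM !mul2n -!addnn !exprD; ring.
rewrite pair_big /= /weight_coef.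
under [RHS]eq_bigr do rewrite mulr_suml.
rewrite [RHS]exchange_big; apply: eq_bigr => k _ /=.
under [RHS]eq_bigr do rewrite mulr_suml.
rewrite [RHS]exchange_big; apply: eq_bigr => u _ /=.
under [RHS]eq_bigr do rewrite mulr_suml.
rewrite [RHS]exchange_big; apply: eq_bigr => v _ /=.
(* One bound serves both exponents: that of X is at most a + b + k, that of Y at most b + k + i +
   j. *)
have hm : (a + b - k + u + v < (3 * a + b).+1)%N.
  by have := ltn_ord k; have := ltn_ord u; have := ltn_ord v; lia.
have hn : (b + k + (i - u) + (j - v) < (3 * a + b).+1)%N.
  by have := ltn_ord k; have := ltn_ord u; have := ltn_ord v; lia.
rewrite (bigD1 (Ordinal hm, Ordinal hn)) //= !eqxx /= big1 ?addr0 // => -[m n].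
by rewrite xpair_eqE -!val_eqE /= => /negPf ->; rewrite mul0r.
Qed.

Definition weight_coef_mx (R : realType) (a b m n : nat) : 'M[R[i]]_a.+1 :=
  \matrix_(i, j) (weight_coef R a b m n i j)%:C.

Lemma weight_expansion (R : realType) (a b : nat) (t1 t2 : R) :
  weight a b t1 t2 =
  \sum_(m < (3 * a + b).+1) \sum_(n < (3 * a + b).+1)
    ((cos t1 ^+ 2) ^+ m * (cos t2 ^+ 2) ^+ n)%:C *: weight_coef_mx R a b m n.
Proof.
apply/matrixP => i j; rewrite weightE weight_entryE -1?ltnS //.
rewrite summxE rmorph_sum; apply: eq_bigr => m _.
rewrite summxE rmorph_sum; apply: eq_bigr => n _.
by rewrite !mxE mulrC rmorphM.
Qed.

(** * Comparison of coefficients *)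

Lemma poly_cos2_eq0 (R : realType) (N : nat) (d : nat -> R[i]) :
  (forall t : R, \sum_(m < N) ((cos t ^+ 2) ^+ m)%:C * d m = 0) ->
  forall m, (m < N)%N -> d m = 0.
Proof.
move=> h.
(* The squared cosines of these angles are the numbers 1/(l+1)^2: N distinct roots of a polynomial
   of size at most N. *)
pose t (l : nat) : R := acos (l.+1%:R^-1).
have tE l : cos (t l) = l.+1%:R^-1.
  rewrite acosK // in_itv /= invf_le1 ?ltr0n // ler1n andbT.
  by rewrite (le_trans (lerN10 _)) // invr_ge0 ler0n.
pose s := [seq (cos (t l) ^+ 2)%:C | l <- iota 0 N].
have s_uniq : uniq s.
  rewrite map_inj_uniq ?iota_uniq // => k l /complexI; rewrite !tE => /eqP.
  rewrite eqrXn2 ?invr_ge0 ?ler0n // => /eqP/invr_inj/eqP.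
  by rewrite eqr_nat => /eqP [].
have p0 : \poly_(m < N) d m = 0.
  apply: (roots_geq_poly_eq0 _ s_uniq).
    apply/allP => _ /mapP[l _ ->]; rewrite /root horner_poly.
    rewrite -[X in _ == X](h (t l)); apply/eqP; apply: eq_bigr => m _.
    by rewrite -rmorphXn mulrC.
  by rewrite size_map size_iota size_poly.
by move=> m mN; have := coef_poly N d m; rewrite p0 coef0 mN.
Qed.

Lemma weight_coef_intertwine (R : realType) (a b : nat) (T T' : 'M[R[i]]_a.+1) :
  (forall t1 t2 : R, T *m weight a b t1 t2 = weight a b t1 t2 *m T') ->
  forall m n, (m <= 3 * a + b)%N -> (n <= 3 * a + b)%N ->
  T *m weight_coef_mx R a b m n = weight_coef_mx R a b m n *m T'.
Proof.
move=> h m n hm hn; apply/eqP; rewrite -subr_eq0; apply/eqP.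
apply/matrixP => i j; rewrite [RHS]mxE.
pose D m n := (T *m weight_coef_mx R a b m n - weight_coef_mx R a b m n *m T') i j.
rewrite -/(D m n).
(* Two comparisons in one variable: first in Y with m fixed, then in X for each fixed t2. *)
apply: (@poly_cos2_eq0 R (3 * a + b).+1 (D m)) => // t2.
move: m hm; apply: (@poly_cos2_eq0 R (3 * a + b).+1
  (fun m => \sum_(n < (3 * a + b).+1) ((cos t2 ^+ 2) ^+ n)%:C * D m n)) => t1.
transitivity ((T *m weight a b t1 t2 - weight a b t1 t2 *m T') i j); last first.
  by rewrite h subrr mxE.
rewrite weight_expansion mulmx_sumr mulmx_suml -sumrB summxE.
apply: eq_bigr => m _.
rewrite mulmx_sumr mulmx_suml -sumrB summxE mulr_sumr.
apply: eq_bigr => n' _.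
by rewrite -scalemxAr -scalemxAl -scalerBr mxE rmorphM mulrA.
Qed.

(** * Two families of coefficient matrices *)

Lemma weight_coef_diag_eq0 (R : realType) (a b n i j : nat) :
  (i, j) != (n, n) -> weight_coef R a b (a + b + n) (b + n) i j = 0.
Proof.
move=> ijn; apply: big1 => k _; apply: big1 => u _; apply: big1 => v _.
case: ifP => // /andP[/eqP em /eqP en]; case/negP: ijn.
have := ltn_ord k; have := ltn_ord u; have := ltn_ord v => hv hu hk.
(* The exponents give u + v = n + k and i + j = 2n. From u <= i, v <= k and from u <= k, v <= j one
   gets n <= i and n <= j, hence i = j = n. *)
by rewrite xpair_eqE; lia.
Qed.

(* The products q_coef R a i k u * q_coef R a j k v have no constant sign, but
   they are positive when u and v are maximal. *)
Lemma weight_coef_gt0 (R : realType) (a b m n i j k : nat) :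
  (i <= a)%N -> (j <= a)%N -> (k <= a)%N ->
  m = (a + b - k + minn i k + minn j k)%N ->
  n = (b + k + (i - minn i k) + (j - minn j k))%N ->
  (forall k u v, (k <= a)%N -> (u <= minn i k)%N -> (v <= minn j k)%N ->
     m = (a + b - k + u + v)%N -> n = (b + k + (i - u) + (j - v))%N ->
     u = minn i k /\ v = minn j k) ->
  0 < weight_coef R a b m n i j.
Proof.
move=> ia ja ka mE nE top.
have ge0 (k' : 'I_a.+1) (u : 'I_(minn i k').+1) (v : 'I_(minn j k').+1) :
    0 <= (if (m == a + b - k' + u + v)%N && (n == b + k' + (i - u) + (j - v))%N
          then q_coef R a i k' u * q_coef R a j k' v else 0).
  case: ifP => // /andP[/eqP em /eqP en].
  have k'a : (k' <= a)%N by rewrite -ltnS.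
  have [-> ->] := top k' u v k'a (ltn_ord u) (ltn_ord v) em en.
  by rewrite mulr_ge0 // ltW // q_coef_top_gt0.
have hk : (k < a.+1)%N by [].
(* The term at the given [k] with [u] and [v] maximal is isolated; all the others are
   nonnegative. *)
rewrite /weight_coef (bigD1 (Ordinal hk)) //= ltr_pwDl //; last first.
  by do 3!(apply: sumr_ge0 => ? _).
rewrite (bigD1 ord_max) //= ltr_pwDl //; last first.
  by do 2!(apply: sumr_ge0 => ? _); apply: (ge0 (Ordinal hk)).
rewrite (bigD1 ord_max) //= ltr_pwDl //; last first.
  by apply: sumr_ge0 => ? _; apply: (ge0 (Ordinal hk) ord_max).
by rewrite -mE -nE !eqxx /= mulr_gt0 ?q_coef_top_gt0.
Qed.

(** Here u + v = n + k with u, v <= min(n, k), which leaves only k = u = v = n. *)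
Lemma weight_coef_diag_gt0 (R : realType) (a b n : nat) :
  (n <= a)%N -> 0 < weight_coef R a b (a + b + n) (b + n) n n.
Proof.
by move=> na; apply: (@weight_coef_gt0 _ _ _ _ _ _ _ n) => //; lia.
Qed.

(** Here u + v = n + k with u <= k and v <= n forces u = k and v = n, so k is n or n + 1; in both
    cases u and v are maximal. *)
Lemma weight_coef_subdiag_gt0 (R : realType) (a b n : nat) :
  (n < a)%N -> 0 < weight_coef R a b (a + b + n) (b + n.+1) n.+1 n.
Proof.
by move=> na; apply: (@weight_coef_gt0 _ _ _ _ _ _ _ n) => //; lia.
Qed.

(** * Intertwiners are scalar *)

(** Leaving [T'] arbitrary treats [T' = T^t*] and [T' = T] at once; in the first case [T' = T] makes
    the scalar real. *)
Lemma weight_intertwiner_scalar (R : realType) (a b : nat)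
    (T T' : 'M[R[i]]_a.+1) :
  (forall t1 t2 : R, T *m weight a b t1 t2 = weight a b t1 t2 *m T') ->
  T = (T 0 0)%:M /\ T' = T.
Proof.
move=> /weight_coef_intertwine h.
(* The coefficient matrix is supported at (n, n), so each product reduces to one term. *)
have diagE n i j : T i n * (weight_coef_mx R a b (a + b + n) (b + n) n j) =
    weight_coef_mx R a b (a + b + n) (b + n) i n * T' n j.
  have hm : (a + b + n <= 3 * a + b)%N by have := ltn_ord n; lia.
  have hn : (b + n <= 3 * a + b)%N by have := ltn_ord n; lia.
  have /matrixP/(_ i j) := h _ _ hm hn.
  rewrite !mxE (bigD1 n) //= big1 ?addr0; last first.
    move=> l ln; rewrite !mxE weight_coef_diag_eq0 ?mulr0 //.
    by rewrite xpair_eqE negb_and; apply/orP; left.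
  rewrite (bigD1 n) //= [X in _ = _ + X -> _]big1 ?addr0; last first.
    move=> l ln; rewrite !mxE weight_coef_diag_eq0 ?mul0r //.
    by rewrite xpair_eqE negb_and; apply/orP; right.
  by rewrite !mxE.
have Cnn (n : 'I_a.+1) : weight_coef_mx R a b (a + b + n) (b + n) n n != 0.
  rewrite mxE -(rmorph0 (real_complex R)) (inj_eq (@complexI R)).
  by rewrite gt_eqF // weight_coef_diag_gt0 // -ltnS.
have T_diag (i n : 'I_a.+1) : i != n -> T i n = 0.
  move=> ni; apply: (mulIf (Cnn n)); rewrite diagE mxE.
  by rewrite weight_coef_diag_eq0 ?mul0r // xpair_eqE negb_and; apply/orP; left.
have T'_diag (n j : 'I_a.+1) : n != j -> T' n j = 0.
  move=> nj; apply: (mulfI (Cnn n)); rewrite -diagE mxE.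
  rewrite weight_coef_diag_eq0 ?mulr0 // xpair_eqE negb_and.
  by apply/orP; right; rewrite eq_sym.
have T'nn (n : 'I_a.+1) : T' n n = T n n.
  by apply: (mulIf (Cnn n)); rewrite diagE mulrC.
have step (n : nat) (hn : (n < a.+1)%N) (hn1 : (n.+1 < a.+1)%N) :
    T (Ordinal hn1) (Ordinal hn1) = T (Ordinal hn) (Ordinal hn).
  have hm : (a + b + n <= 3 * a + b)%N by lia.
  have hn' : (b + n.+1 <= 3 * a + b)%N by lia.
  (* As [T] and [T'] are diagonal, this entry of the identity relates only the diagonal entries n +
     1 of [T] and n of [T'], through a nonzero factor. *)
  have /matrixP/(_ (Ordinal hn1) (Ordinal hn)) := h _ _ hm hn'.
  rewrite !mxE (bigD1 (Ordinal hn1)) //= big1 ?addr0; last first.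
    by move=> l ln; rewrite T_diag ?mul0r // eq_sym.
  rewrite (bigD1 (Ordinal hn)) //= [X in _ = _ + X -> _]big1 ?addr0; last first.
    by move=> l ln; rewrite T'_diag ?mulr0.
  rewrite mulrC T'nn => /mulfI; apply.
  rewrite mxE -(rmorph0 (real_complex R)) (inj_eq (@complexI R)).
  by rewrite gt_eqF // weight_coef_subdiag_gt0.
have Tnn (n : nat) (hn : (n < a.+1)%N) : T (Ordinal hn) (Ordinal hn) = T 0 0.
  elim: n hn => [|n IH] hn; first by congr (T _ _); apply: val_inj.
  by rewrite (step n (ltnW hn)) IH.
split; apply/matrixP => i j.
  rewrite mxE; have [<-|/T_diag //] := eqVneq i j.
  by case: i => n hn; rewrite mulr1n Tnn.
by have [<-|ij] := eqVneq i j; rewrite ?T'nn // T_diag ?T'_diag.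
Qed.

Theorem proposition5p1 (R : realType) (a b : nat) :
  [set T : 'M[R[i]]_a.+1 | forall t1 t2 : R,
      T *m weight a b t1 t2 = weight a b t1 t2 *m T^t*]
    = [set (r%:C)%:M | r in [set: R]]
  /\
  [set T : 'M[R[i]]_a.+1 | forall t1 t2 : R,
      T *m weight a b t1 t2 = weight a b t1 t2 *m T]
    = [set z%:M | z in [set: R[i]]].
Proof.
split; apply/seteqP; split => T /=.
- move=> /weight_intertwiner_scalar[TE TT].
  have /matrixP/(_ 0 0) := TT; rewrite !mxE => Treal.
  exists (complex.Re (T 0 0)) => //; rewrite [RHS]TE; congr (_%:M).
  (* Equality with the conjugate gives -y = y for the imaginary part y. *)
  case: (T 0 0) Treal => x y [] /eqP.
  by rewrite eqNr => /eqP ->.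
- move=> [r _ <-] t1 t2.
  have -> : ((r%:C)%:M : 'M[R[i]]_a.+1)^t* = (r%:C)%:M.
    rewrite tr_scalar_mx map_scalar_mx; congr (_%:M); exact: conjc_real.
  by rewrite scalar_mxC.
- by move=> /weight_intertwiner_scalar[TE _]; exists (T 0 0).
- by move=> [z _ <-] t1 t2; rewrite scalar_mxC.
Qed.
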